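(* Let $\Omega$ be a Cantor group and let $T:\Omega\to\Omega$ be a minimal translation. There exists a dense $G_\delta$ set $\mathcal G\subseteq C(\Omega,\mathbb D)$ such that for every $f\in\mathcal G$ and every $\omega\in\Omega$, the extended CMV operator $\mathcal E_{f}=\mathcal E_{f,\omega}$ on $\ell^2(\mathbb Z)$ with Verblunsky coefficients $\alpha_n=f(T^n\omega)$, $n\in\mathbb Z$, has empty point spectrum (i.e. no eigenvalues with eigenvectors in $\ell^2(\mathbb Z)$).
   Context: $\mathbb D=\{z\in\mathbb C:|z|<1\}$. A Cantor group $\Omega$ is a totally disconnected compact Abelian (Hausdorff) topological group with no isolated points. A translation is a map $T:\Omega\to\Omega$ of the form $T\omega=\omega+a$ for some $a\in\Omega$; it is minimal if the $T$-orbit $\{T^n\omega:n\in\mathbb Z\}$ of every $\omega\in\Omega$ is dense in $\Omega$. $C(\Omega,\mathbb D)$ is the set of continuous functions $\Omega\to\mathbb D$ (sampling functions) with the topology of the supremum norm. For a two-sided sequence $(\alpha_n)_{n\in\mathbb Z}$ in $\mathbb D$ (Verblunsky coefficients), put $\rho_n=\sqrt{1-|\alpha_n|^2}$. The extended CMV operator $\mathcal E$ is the unitary operator on $\ell^2(\mathbb Z)$ given, for every odd $n\in\mathbb Z$, by $$(\mathcal E u)_{n+1}=\bar\alpha_{n+1}\rho_n u_n-\bar\alpha_{n+1}\alpha_n u_{n+1}+\bar\alpha_{n+2}\rho_{n+1}u_{n+2}+\rho_{n+2}\rho_{n+1}u_{n+3},$$ $$(\mathcal E u)_{n+2}=\rho_{n+1}\rho_n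 u_n-\rho_{n+1}\alpha_n u_{n+1}-\bar\alpha_{n+2}\alpha_{n+1}u_{n+2}-\rho_{n+2}\alpha_{n+1}u_{n+3}.$$ *)

(* Defs.v *)
From HB Require Import structures.
From mathcomp Require Import all_boot all_order all_algebra.
From mathcomp Require Import all_classical all_reals all_analysis.
From mathcomp Require Import borel_hierarchy complex.
From mathcomp Require Import zify.
Import Order.TTheory GRing.Theory Num.Theory.
Import numFieldNormedType.Exports.
Import Normc.

Set Implicit Arguments.
Unset Strict Implicit.
Unset Printing Implicit Defensive.

Local Open Scope classical_set_scope.
Local Open Scope ring_scope.

(* Compactness is only the covering property in the library, so the Hausdorff
   axiom is listed separately.  Being a topological abelian group is part of
   the type of Omega. *)
Definition cantor_group (Omega : topologicalZmodType) : Prop :=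
  [/\ compact [set: Omega], hausdorff_space Omega,
      totally_disconnected [set: Omega] & isolated [set: Omega] = set0].

Definition is_translation (Omega : zmodType) (T : Omega -> Omega) : Prop :=
  exists a : Omega, forall w, T w = w + a.

(* T^n for n in Z.  Negz k stands for -(k+1); 'pinv_d setT T is the two-sided
   inverse of T whenever T is bijective, in particular for translations. *)
Definition iterz (Omega : zmodType) (T : Omega -> Omega) (n : int) :
    Omega -> Omega :=
  match n with
  | Posz k => iter k T
  | Negz k => iter k.+1 ('pinv_(fun=> 0) [set: Omega] T)
  end.

Lemma iterz_translation (Omega : zmodType) (a : Omega) (n : int) w :
  iterz (fun w => w + a) n w = w + a *~ n.
Proof.
have Tinv v : 'pinv_(fun=> 0) [set: Omega] (fun w => w + a) v = v - a.
  have vim : v \in (fun w : Omega => w + a) @` [set: Omega].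
    by rewrite inE; exists (v - a) => //=; rewrite subrK.
  by apply: (addIr a); rewrite subrK; exact: (pinvK (fun=> 0) vim).
case: n => k /=.
  by elim: k => [|k IHk] /=; rewrite ?mulr0z ?addr0// IHk -addrA -mulrSr.
rewrite NegzE mulrNz; elim: k => [|k IHk]; first by rewrite /= Tinv.
by rewrite iterS IHk Tinv -addrA -opprD -mulrSr.
Qed.

Definition minimal (Omega : topologicalZmodType) (T : Omega -> Omega) : Prop :=
  forall w : Omega, dense (range (fun n : int => iterz T n w)).

Section ExtendedCMV.
Variable R : realType.

(* The set C(Omega, D) inside the space of all functions Omega -> C with the
   topology of uniform convergence.  Used as a type, it carries the induced
   topology, which on a compact Omega is that of the supremum norm.  The
   topology of C is the one of the regular module R[i]^o, given by the
   modulus. *)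
Definition sampling_functions (Omega : topologicalType) :
    set {uniform Omega -> R[i]^o} :=
  [set f | continuous (f : Omega -> R[i]^o) /\ forall w, normc (f w) < 1].

Arguments sampling_functions : clear implicits.

Lemma nbhs_sampling_functions (Omega : topologicalType)
    (f : sampling_functions Omega) (U : set (sampling_functions Omega)) :
  nbhs f U <-> exists2 e : R, 0 < e &
    forall g : sampling_functions Omega,
      (forall w, normc (set_val f w - set_val g w) < e) -> U g.
Proof.
have normE (z : R[i]) : `|z| = (normc z)%:C%C by [].
split=> [[_ [[B oB <-] Bf BU]]|[e e0 eU]].
  have /uniform_nbhs[E [entE EB]] : nbhs (set_val f) B by exact: open_nbhs_nbhs.
  have [d /= d0 dE] : exists2 d : R[i], 0 < d &
      [set xy : R[i]^o * R[i]^o | ball xy.1 d xy.2] `<=` E.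
    by move: entE; rewrite -entourage_ballE.
  have [r r0 rd] : exists2 r : R, 0 < r & d = r%:C%C.
    exists (complex.Re d); first by move: d0; rewrite ltcE => /andP[].
    by case: d d0 {dE} => x y; rewrite ltcE /= => /andP[/eqP-> _].
  exists r => // g gf; apply: BU; apply: EB => w _; apply: dE => /=.
  by rewrite -ball_normE /ball_ /= rd normE ltcR.
pose E := [set xy : R[i]^o * R[i]^o | ball xy.1 (e%:C%C : R[i]) xy.2].
have entE : entourage E.
  by rewrite -entourage_ballE; exists e%:C%C => //=; rewrite ltcR.
have : nbhs (set_val f) [set h : {uniform Omega -> R[i]^o} |
    forall w, normc (set_val f w - h w) < e].
  apply/uniform_nbhs; exists E; split=> // h Eh w.
  by move: (Eh w I); rewrite /E /= -ball_normE /ball_ /= normE ltcR.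
rewrite nbhsE => -[B [oB Bf] Be].
by exists (set_val @^-1` B); split=> //=; [exists B | move=> g /Be /eU].
Qed.

Definition rho (a : int -> R[i]) (n : int) : R[i] :=
  (Num.sqrt (1 - normc (a n) ^+ 2))%:C%C.

(* The row of index m is the row n + 1 (m even) or n + 2 (m odd) of the
   two-row block attached to an odd n; see extCMV_odd. The formula makes sense
   for every sequence u; square summability is imposed in point_spectrum. *)
Definition extCMV (a : int -> R[i]) (u : int -> R[i]) (m : int) : R[i] :=
  if (2 %| m)%Z then
    let n := m - 1 in
    (a (n + 1))^*%C * rho a n * u n
    - (a (n + 1))^*%C * a n * u (n + 1)
    + (a (n + 2))^*%C * rho a (n + 1) * u (n + 2)
    + rho a (n + 2) * rho a (n + 1) * u (n + 3)
  else
    let n := m - 2 in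
    rho a (n + 1) * rho a n * u n
    - rho a (n + 1) * a n * u (n + 1)
    - (a (n + 2))^*%C * a (n + 1) * u (n + 2)
    - rho a (n + 2) * a (n + 1) * u (n + 3).

Lemma extCMV_odd (a u : int -> R[i]) (n : int) : ~~ (2 %| n)%Z ->
  extCMV a u (n + 1) =
    (a (n + 1))^*%C * rho a n * u n
    - (a (n + 1))^*%C * a n * u (n + 1)
    + (a (n + 2))^*%C * rho a (n + 1) * u (n + 2)
    + rho a (n + 2) * rho a (n + 1) * u (n + 3)
  /\
  extCMV a u (n + 2) =
    rho a (n + 1) * rho a n * u n
    - rho a (n + 1) * a n * u (n + 1)
    - (a (n + 2))^*%C * a (n + 1) * u (n + 2)
    - rho a (n + 2) * a (n + 1) * u (n + 3).
Proof.
move=> n_odd; rewrite /extCMV !addrK.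
have -> : (2 %| n + 1)%Z by move: n_odd; rewrite !dvdzE /=; lia.
have /negbTE -> : ~~ (2 %| n + 2)%Z by move: n_odd; rewrite !dvdzE /=; lia.
by [].
Qed.

Definition l2 (u : int -> R[i]) : Prop :=
  summable [set: int] (fun n => (normc (u n) ^+ 2)%:E).

Definition point_spectrum (A : (int -> R[i]) -> (int -> R[i])) : set R[i] :=
  [set z | exists u : int -> R[i],
    [/\ l2 u, u <> (fun=> 0) & A u = (fun n => z * u n)]].

End ExtendedCMV.

Arguments sampling_functions : clear implicits.

(* Main.v *)
Require Import Defs.
From mathcomp Require Import all_boot all_order all_algebra.
From mathcomp Require Import finmap.
From mathcomp Require Import all_classical all_reals all_analysis.
From mathcomp Require Import borel_hierarchy complex.
From mathcomp Require Import zify ring lra.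
Import Order.TTheory GRing.Theory Num.Theory.
Import numFieldNormedType.Exports.
Import Normc.

Local Open Scope classical_set_scope.
Local Open Scope ring_scope.

Set Implicit Arguments.
Unset Strict Implicit.
Unset Printing Implicit Defensive.

(** The generic set consists of the sampling functions that are extremely well
    approximated by periodic ones: [f] belongs to it when for arbitrarily large
    even [q] the sup norm of [f o T^q - f] is less than [1 / q!].

    Size of the set.  For a fixed lower bound [j] on [q] the condition is open
    ([open_gordon_fun]), so the set is a countable intersection of open sets.
    It is dense because it contains every periodic sampling function
    ([periodic_gordon_fun]), and these are already dense.  To approximate a
    continuous [h] by a periodic function, use that the open subgroups of a
    Cantor group form a basis of neighbourhoods of 0 ([open_subgroup_basis]):
    compactness makes [h] uniformly continuous, hence [h] is almost constant on
    the cosets of some open subgroup [S], and it may be replaced by its value at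
    one point of each coset ([subgroup_periodic_approx]).  The result is
    invariant under translations by [S], and minimality provides a positive
    multiple of the translation vector in [S] ([translation_returns]).

    Absence of eigenvalues.  Split the extended CMV operator as [E = L M], with
    [L] and [M] block diagonal with 2 x 2 blocks, and put [v = M u].  The
    equation [E u = z u] then becomes a one-step recursion for the vectors
    [(u_n, v_n)] whose matrices have determinant -1 ([cmv_stateS],
    [det_transfer]).  This holds for every [z] different from 0, on the unit
    circle or not, and [z = 0] is excluded by the injectivity of [E]
    ([extCMV_inj]).  Let [A] be the product of the matrices over a block of even
    length [q], so that [det A = 1].  If the Verblunsky coefficients were exactly
    [q]-periodic, the Cayley-Hamilton identity [A^2 - (tr A) A + 1 = 0] would
    prevent the state at a site [n] from being much larger than all three of the
    states at [n - q], [n + q] and [n + 2 q] ([three_block_bound]).  Products of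
    [q] matrices amplify errors by at most a factor exponential in [q], which
    [1 / q!] beats, so the conclusion survives under approximate periodicity
    ([gordon]).  The states built from a square summable [u] tend to 0 at both
    ends of the line, hence they all vanish. *)

(** * Open subgroups of totally disconnected compact groups *)

(** Compactness of the complement of [U]: finitely many of the clopen sets
    around [x] already exclude it, and their intersection is clopen. *)
Lemma clopen_sub_open (X : topologicalType) (x : X) (U : set X) :
  compact [set: X] -> open U ->
  (forall y, (forall D, clopen D -> D x -> D y) -> U y) ->
  exists D, [/\ clopen D, D x & D `<=` U].
Proof.
move=> cX oU QU; pose F := filter_from [set D : set X | D x /\ clopen D] id.
have FF : Filter F.
  apply: filter_from_filter; first by exists setT; split => //; exact: clopenT.
  by move=> A B [? ?] [? ?]; exists (A `&` B) => //; split=> //; exact: clopenI.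
have PF : ProperFilter F by apply: filter_from_proper; move=> ? [? _]; exists x.
have /compact_near_coveringP : compact (~` U).
  by apply: (subclosed_compact _ cX) => //; exact: open_closedC.
move=> /(_ _ _ setC (powerset_filter_from_filter PF))[].
  move=> y nUy; have [C [[oC cC] Cx nCy]] :
      exists C, [/\ clopen C, C x & ~ C y].
    apply: contrapT => noC; apply/nUy/QU => D cD Dx.
    by apply: contrapT => nDy; apply: noC; exists D.
  exists (~` C, [set V | V `<=` C]); first split.
  - by apply: open_nbhs_nbhs; split => //; exact: closed_openC.
  - apply/near_powerset_filter_fromP; first by move=> ? ?; exact: subset_trans.
    by exists C => //; exists C.
  - by case=> i j [? /subsetC]; apply.
move=> E [EF _ [C EC]] /(_ _ EC) UC.
have [D [Dx cD] DC] := EF _ EC.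
by exists D; split=> // y /DC Cy; apply: contrapT => /UC.
Qed.

(** If the intersection of all clopen neighbourhoods of [x] split into two
    closed pieces, normality would separate these by open sets, and
    [clopen_sub_open] would give a clopen neighbourhood of [x] lying in their
    union, whose part around the piece of [x] is clopen and misses the other
    piece. *)
Lemma quasicomponent_connected (X : topologicalType) (x : X) :
  compact [set: X] -> hausdorff_space X ->
  connected [set y | forall D, clopen D -> D x -> D y].
Proof.
move=> cX hX; set Q := [set y | _].
have clQ : closed Q.
  rewrite (_ : Q = \bigcap_(D in [set D | clopen D /\ D x]) D).
    by apply: closed_bigI => D [[_ ?] _].
  by apply/seteqP; split=> [y Qy D [? ?]|y Qy D ? ?]; apply: Qy.
apply/connectedP => E [E0 EU sE].
wlog Ex : E E0 EU sE / E false x.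
  move=> G; have : Q x by [].
  rewrite EU => -[E0c|E1c]; first exact: (G E).
  by apply: (G (E \o negb)) => //;
    [case => /=|rewrite EU setUC|rewrite separatedC].
have clE : closed (E false).
  move=> y cEy; have : Q y.
    by apply: clQ; apply: closureS cEy; rewrite EU; exact: subsetUl.
  rewrite EU => -[//|Ey]; exfalso.
  by have /seteqP[+ _] := sE.1; apply; split; [exact: cEy|exact: Ey].
have clE' : closed (E true).
  move=> y cEy; have : Q y.
    by apply: clQ; apply: closureS cEy; rewrite EU; exact: subsetUr.
  rewrite EU => -[Ey|//]; exfalso.
  by have /seteqP[+ _] := sE.2; apply; split; [exact: Ey|exact: cEy].
have nE : set_nbhs (E false) (~` E true).
  move=> y Ey; apply: open_nbhs_nbhs; split; first exact: closed_openC.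
  by move=> Ey'; have /seteqP[+ _] := separated_disjoint sE; apply; split;
    [exact: Ey|].
have [B /set_nbhsP[U [oU EU' UB]] BE] := compact_normal hX cX clE nE.
have [D [cD Dx DUB]] : exists D, [/\ clopen D, D x & D `<=` U `|` ~` closure B].
  apply: clopen_sub_open => //.
    by apply: openU => //; apply: closed_openC; exact: closed_closure.
  move=> y Qy; have : Q y by [].
  rewrite EU => -[/EU'|Ey]; first by left.
  by right=> /BE.
have [y Ey] := E0 true.
have [_ Uy] : (D `&` U) y.
  have : Q y by rewrite EU; right.
  apply; last by split=> //; exact: EU'.
  split; first by case: cD => oD _; exact: openI.
  rewrite (_ : D `&` U = D `&` closure B).
    by case: cD => _ clD; apply: closedI => //; exact: closed_closure.
  apply/seteqP; split=> t [Dt Bt]; split=> //.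
    by apply: subset_closure; exact: UB.
  by case: (DUB t Dt).
by apply: (BE y) => //; apply: subset_closure; exact: UB.
Qed.

(** In a totally disconnected space the connected intersection of the clopen
    neighbourhoods of [x] is reduced to [x]. *)
Lemma clopen_nbhs_basis (X : topologicalType) (x : X) (V : set X) :
  compact [set: X] -> hausdorff_space X -> totally_disconnected [set: X] ->
  nbhs x V -> exists D, [/\ clopen D, D x & D `<=` V].
Proof.
move=> cX hX tX; rewrite nbhsE => -[U [oU Ux] UV].
have [y Qy|D [cD Dx DU]] := @clopen_sub_open _ x U cX oU; last first.
  by exists D; split=> //; exact: subset_trans UV.
suff -> : y = x by [].
have /seteqP[+ _] := tX x I; apply.
exists [set y | forall D, clopen D -> D x -> D y] => //.
by split=> //; exact: quasicomponent_connected.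
Qed.

(** A form of uniform continuity on a compact group, by the tube lemma: it
    serves for the relation of lying on the same side of a clopen set and for
    the relation of having images at distance less than a given bound. *)
Lemma compact_near_addr (G : topologicalZmodType) (P : G -> G -> Prop) :
  compact [set: G] ->
  (forall x y, P x y -> \forall x' \near x & y' \near y, P x' y') ->
  (forall x, P x x) -> \forall s \near (0 : G), forall x, P x (x + s).
Proof.
move=> /compact_near_coveringP cG oP Pxx.
have := cG G (nbhs 0) (fun s x => P x (x + s)) _ _; rewrite /= => cG'.
have : \forall s \near (0 : G), [set: G] `<=` (fun x => P x (x + s)).
  apply: cG' => x _.
  have [[A B] /= [Ax Bx] AB] := oP x x (Pxx x).
  have /= : (fun p : G * G => p.1 + p.2) @ (x, (0 : G)) --> x + 0.
    exact: (@add_continuous G (x, 0)).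
  rewrite addr0 => /(_ B Bx)[[A' S] /= [A'x S0] AS].
  exists (A `&` A', S); first by split=> //; exact: filterI.
  move=> [y s] /= [[Ay A'y] Ss]; apply: (AB (y, y + s)); split=> //=.
  exact: (AS (y, s)).
by apply: filterS => s Ps x; apply: Ps.
Qed.

Lemma near_translate (G : topologicalZmodType) (x : G) (S : set G) :
  nbhs 0 S -> \forall y \near x, S (y - x).
Proof.
have cvx : (fun y => y - x) @ x --> x - x.
  apply: (@continuous2_cvg _ _ _ _ _ _ id (cst x) (fun y z => y - z)) => //.
    exact: (@sub_continuous G (x, x)).
  exact: cvg_cst.
by move=> nS; apply: (cvx S); rewrite subrr.
Qed.

(** The translations that stabilize a clopen neighbourhood of 0 form a
    subgroup contained in that neighbourhood; it is open because translations
    close to 0 stabilize a clopen set. *)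
Lemma open_subgroup_basis (G : topologicalZmodType) (V : set G) :
  compact [set: G] -> hausdorff_space G -> totally_disconnected [set: G] ->
  nbhs 0 V ->
  exists S : set G, [/\ open S, S 0, (forall s t, S s -> S t -> S (s - t)) &
    S `<=` V].
Proof.
move=> cG hG tG V0; have [U [[oU clU] U0 UV]] := clopen_nbhs_basis cG hG tG V0.
pose S := [set s | forall x, U x <-> U (x + s)].
have S0 : S 0 by move=> x; rewrite addr0.
have SB s t : S s -> S t -> S (s - t).
  move=> Ss St x; rewrite (Ss x) (St (x + (s - t))).
  by rewrite -addrA subrK.
have nS : nbhs 0 S.
  apply: (@compact_near_addr G (fun x y => U x <-> U y)) => // x y Uxy.
  have [Ux|nUx] := pselect (U x).
    exists (U, U) => /=; last by move=> [? ?] [? ?]; split.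
    by split; apply: open_nbhs_nbhs; split=> //; exact/Uxy.
  exists (~` U, ~` U) => /=; last by move=> [? ?] [? ?]; split.
  split; apply: open_nbhs_nbhs; split; try exact: closed_openC.
    by [].
  by move/Uxy.
exists S; split; [|exact: S0|exact: SB|]; last first.
  by move=> s /(_ 0) [/(_ U0) + _]; rewrite add0r => /UV.
rewrite openE => s Ss; rewrite /interior /=.
apply: filterS (near_translate s nS) => t St.
rewrite -[t](subrK s) -[s in X in S (_ + X)]opprK; apply: (SB) => //.
by rewrite -sub0r; exact: SB.
Qed.

(** * Periodic approximation *)

Lemma normcB (R : rcfType) (x y : R[i]) : normc (x - y) = normc (y - x).
Proof. by rewrite -[x - y]opprB normcN. Qed.

Lemma le_normcB (R : rcfType) (y x z : R[i]) :
  normc (x - z) <= normc (x - y) + normc (y - z).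
Proof. by rewrite -[x - z](subrKA y) le_normcD. Qed.

Lemma near_normc (R : realType) (X : topologicalType) (f : X -> R[i]^o) (x : X)
    (e : R) :
  {for x, continuous f} -> 0 < e ->
  \forall y \near x, normc ((f x : R[i]) - f y) < e.
Proof.
have normE (z : R[i]) : `|z| = (normc z)%:C%C by [].
move=> fx e0; have e0' : 0 < (e%:C%C : R[i]) by rewrite ltcR.
have /cvgrPdist_lt/(_ _ e0') := fx : f @ x --> f x.
apply: (@filterS _ (nbhs x)) => y.
by rewrite normE ltcR.
Qed.

(** The map [r] picks one point in each coset of [S].  As [xget] depends only
    on the set from which it chooses, [r] is constant on cosets.  Composing [h]
    with [r], instead of averaging [h] over the cosets, keeps the values in the
    range of [h], in particular in the open unit disk. *)
Lemma subgroup_periodic_approx (R : realType) (G : topologicalZmodType)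
    (h : G -> R[i]^o) (e : R) :
  compact [set: G] -> hausdorff_space G -> totally_disconnected [set: G] ->
  continuous h -> 0 < e ->
  exists (S : set G) (r : G -> G),
    [/\ open S, S 0, (forall s t, S s -> S t -> S (s - t)),
        (forall x s, S s -> r (x + s) = r x) &
        continuous (h \o r) /\
        forall x, normc ((h x : R[i]) - h (r x)) < e].
Proof.
move=> cG hG tG ch e0.
pose P x y := normc ((h x : R[i]) - h y) < e.
have oP x y : P x y -> \forall x' \near x & y' \near y, P x' y'.
  rewrite /P => Pxy; set d := (e - normc ((h x : R[i]) - h y)) / 2.
  have d0 : 0 < d by rewrite /d; lra.
  exists ([set x' | normc ((h x : R[i]) - h x') < d],
          [set y' | normc ((h y : R[i]) - h y') < d]).
    by split; apply: (@near_normc _ _ h _ d _ d0); exact: ch.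
  move=> [x' y'] /= [hx hy]; rewrite normcB in hx.
  have := le_normcB (h x) (h x') (h y').
  have := le_normcB (h y) (h x) (h y').
  by rewrite /d in hx hy; lra.
have Pxx x : P x x by rewrite /P subrr normc0.
have [S [oS S0 SB SP]] :=
  open_subgroup_basis cG hG tG (compact_near_addr cG oP Pxx).
pose r x := xget 0 [set y | S (y - x)].
have rS x s : S s -> r (x + s) = r x.
  move=> Ss; rewrite /r; congr xget; apply/seteqP; split=> y /= Sy.
    have -> : y - x = y - (x + s) - (0 - s).
      by rewrite sub0r opprK opprD addrA subrK.
    by apply: (SB) => //; exact: SB.
  by rewrite opprD addrA; exact: SB.
have rx x : S (r x - x).
  by apply: (@xgetPex _ 0 [set y | S (y - x)]); exists x; rewrite /= subrr.
exists S, r; split; [exact: oS|exact: S0|exact: SB|exact: rS|split].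
  move=> x; apply: cvg_near_cst.
  have nS : nbhs 0 S by exact: open_nbhs_nbhs.
  apply: filterS (near_translate x nS) => y Sy.
  have ry : r y = r x by rewrite -(rS x _ Sy) addrC subrK.
  by rewrite /comp ry.
move=> x; have := SP _ (rx x) x; rewrite /P [x + _]addrC subrK; exact.
Qed.

(** Since 0 is not isolated, [S] minus 0 is a nonempty open set, which the
    orbit of 0 must meet.  The time of this visit is nonzero, and its sign can
    be changed because [S] is a subgroup. *)
Lemma translation_returns (G : topologicalZmodType) (a : G) (S : set G) :
  hausdorff_space G -> isolated [set: G] = set0 ->
  minimal (fun w : G => w + a) ->
  open S -> S 0 -> (forall s t, S s -> S t -> S (s - t)) ->
  exists2 m, (0 < m)%N & S (a *+ m).
Proof.
move=> hG iG mG oS S0 SB.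
have [n [[S_n n0] [m _ mE]]] : (S `\` [set 0]) `&`
    range (fun n : int => iterz (fun w : G => w + a) n 0) !=set0.
  apply: mG.
    apply: contrapT => S0'; have : isolated [set: G] 0; last by rewrite iG.
    split; first exact: in_setT.
    exists S; first exact: open_nbhs_nbhs.
    rewrite setIT; apply/seteqP; split=> [s Ss|_ -> //].
    by apply: contrapT => s0; apply: S0'; exists s.
  apply: openI => //; apply: closed_openC.
  exact: (accessible_closed_set1 (hausdorff_accessible hG)).
move: mE S_n n0; rewrite iterz_translation add0r => <- {n}.
case: m => [[|m]|m] /=; rewrite -?pmulrn.
- by rewrite mulr0n.
- by move=> *; exists m.+1.
- rewrite NegzE mulrNz -pmulrn => Sm _; exists m.+1 => //.
  by rewrite -[a *+ _]opprK -sub0r; exact: SB.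
Qed.

(** * A norm on matrices and the three-block bound *)

Section MatrixNorm.
Variable R : rcfType.
Local Notation C := R[i].

Lemma normc_ge0 (x : C) : 0 <= normc x.
Proof. by case: x => a b; exact: sqrtr_ge0. Qed.

Lemma le_normc_sum (I : finType) (F : I -> C) :
  normc (\sum_i F i) <= \sum_i normc (F i).
Proof.
elim/big_rec2: _ => [|i y x _ xy]; first by rewrite normc0.
by apply: le_trans (le_normcD _ _) _; rewrite lerD2l.
Qed.

(** The entrywise l1 norm is submultiplicative, and on 2 x 2 matrices it is
    invariant under passing to the adjugate. *)
Definition mxnorm1 m n (A : 'M[C]_(m, n)) : R := \sum_i \sum_j normc (A i j).

Lemma mxnorm1_ge0 m n (A : 'M[C]_(m, n)) : 0 <= mxnorm1 A.
Proof. by apply: sumr_ge0 => i _; apply: sumr_ge0 => j _; exact: normc_ge0. Qed.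

Lemma mxnorm1D m n (A B : 'M[C]_(m, n)) :
  mxnorm1 (A + B) <= mxnorm1 A + mxnorm1 B.
Proof.
rewrite -big_split; apply: ler_sum => i _; rewrite -big_split.
by apply: ler_sum => j _; rewrite mxE; exact: le_normcD.
Qed.

Lemma mxnorm1N m n (A : 'M[C]_(m, n)) : mxnorm1 (- A) = mxnorm1 A.
Proof. by do 2!apply: eq_bigr => ? _; rewrite mxE normcN. Qed.

Lemma mxnorm1Z m n (c : C) (A : 'M[C]_(m, n)) :
  mxnorm1 (c *: A) = normc c * mxnorm1 A.
Proof.
rewrite mulr_sumr; apply: eq_bigr => i _; rewrite mulr_sumr.
by apply: eq_bigr => j _; rewrite mxE normcM.
Qed.

Lemma mxnorm1M m n p (A : 'M[C]_(m, n)) (B : 'M[C]_(n, p)) :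
  mxnorm1 (A *m B) <= mxnorm1 A * mxnorm1 B.
Proof.
rewrite mulr_suml; apply: ler_sum => i _.
apply: (@le_trans _ _ (\sum_k \sum_j normc (A i j) * normc (B j k))).
  apply: ler_sum => k _; rewrite mxE; apply: le_trans (le_normc_sum _) _.
  by apply: ler_sum => j _; rewrite normcM.
rewrite exchange_big mulr_suml; apply: ler_sum => j _; rewrite -mulr_sumr.
apply: ler_wpM2l; first exact: normc_ge0.
rewrite /mxnorm1 (bigD1 j)//= lerDl.
by apply: sumr_ge0 => ? _; apply: sumr_ge0 => ? _; exact: normc_ge0.
Qed.

Lemma mxnorm1_eq0 m n (A : 'M[C]_(m, n)) : mxnorm1 A = 0 -> A = 0.
Proof.
move=> /eqP; rewrite psumr_eq0 => [|i _]; last first.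
  by apply: sumr_ge0 => j _; exact: normc_ge0.
move=> /allP A0; apply/matrixP => i j; have := A0 i (mem_index_enum _).
rewrite /= psumr_eq0 => [/allP/(_ j (mem_index_enum _))/eqP/eq0_normc ->|k _].
  by rewrite mxE.
exact: normc_ge0.
Qed.

Lemma sum_ord2 (V : nmodType) (F : 'I_2 -> V) : \sum_i F i = F 0 + F 1.
Proof. by rewrite big_ord_recl big_ord1; congr (_ + F _); exact: val_inj. Qed.

Lemma ord2P (i : 'I_2) : i = 0 \/ i = 1.
Proof. by case: i => [[|[|//]] ?]; [left|right]; exact: val_inj. Qed.

Lemma mx22P n (A B : 'M[C]_(2, n)) :
  (forall j, A 0 j = B 0 j) -> (forall j, A 1 j = B 1 j) -> A = B.
Proof.
move=> AB0 AB1; apply/matrixP => i j.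
by have [->|->] := ord2P i; [exact: AB0|exact: AB1].
Qed.

Lemma det_mx22 (A : 'M[C]_2) : \det A = A 0 0 * A 1 1 - A 0 1 * A 1 0.
Proof.
rewrite (expand_det_row _ 0) sum_ord2 /cofactor !det_mx11 !mxE /=.
have -> : lift 0 0 = 1 :> 'I_2 by exact: val_inj.
have -> : lift 1 0 = 0 :> 'I_2 by exact: val_inj.
by rewrite /= expr0 expr1 mul1r mulN1r mulrN.
Qed.

(** The adjugate of a 2 x 2 matrix is its trace minus itself. *)
Lemma Cayley_Hamilton2 (A : 'M[C]_2) :
  A *m ((\tr A)%:M - A) = (\det A)%:M.
Proof.
rewrite det_mx22 /mxtrace sum_ord2.
by apply: mx22P => j; have [->|->] := ord2P j;
  rewrite !mxE sum_ord2 !mxE /= ?mulr1n ?mulr0n; ring.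
Qed.

Lemma mxnorm1_trB (A : 'M[C]_2) : mxnorm1 ((\tr A)%:M - A) = mxnorm1 A.
Proof.
rewrite /mxnorm1 /mxtrace !sum_ord2 !mxE /= !mulr1n !mulr0n !sub0r !normcN.
have -> : A 0 0 + A 1 1 - A 0 0 = A 1 1 by ring.
have -> : A 0 0 + A 1 1 - A 1 1 = A 0 0 by ring.
lra.
Qed.

(** Think of [w], [x], [y], [z] as states at the sites [n - q], [n], [n + q],
    [n + 2 q], with [A'] and [B] close to [A].  Cayley-Hamilton expresses [x] as
    [t y - z] and [t x] as [y + w], up to errors, with [t = tr A].  The first
    relation bounds [x] when [t] has modulus at most 1, the second when it has
    modulus at least 1. *)
Lemma three_block_bound (A A' B : 'M[C]_2) (w x y z : 'cV[C]_2) :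
  \det A = 1 -> x = B *m w -> y = A *m x -> z = A' *m y ->
  mxnorm1 x <= mxnorm1 w + mxnorm1 y + mxnorm1 z
    + mxnorm1 (A' - A) * mxnorm1 y + mxnorm1 A * mxnorm1 (B - A) * mxnorm1 w.
Proof.
move=> dA xE yE zE.
set t := \tr A.
have CH := Cayley_Hamilton2 A; rewrite dA -/t in CH.
have CH' : (t%:M - A) *m A = 1%:M.
  by rewrite mulmxBl -scalar_mxC -mulmxBr.
have fwd : x = t *: y - z + (A' - A) *m y.
  rewrite mulmxBl -zE -{1}[x]mul1mx -CH mulmxBr scalar_mxC mulmxBl.
  rewrite -!mulmxA -yE mul_scalar_mx.
  by rewrite addrA subrK.
have bwd : t *: x = y + w + (t%:M - A) *m (B - A) *m w.
  rewrite mulmxBr mulmxBl CH' mul1mx -!mulmxA -xE yE mulmxBl mul_scalar_mx.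
  by rewrite -[X in _ = _ + X]addrA -opprD addrCA addrN addr0.
have := mxnorm1_ge0 w; have := mxnorm1_ge0 y; have := mxnorm1_ge0 z.
have := mxnorm1_ge0 x => x0 z0 y0 w0.
have e1 : 0 <= mxnorm1 (A' - A) * mxnorm1 y by rewrite mulr_ge0 ?mxnorm1_ge0.
have e2 : 0 <= mxnorm1 A * mxnorm1 (B - A) * mxnorm1 w.
  by rewrite !mulr_ge0 ?mxnorm1_ge0.
have [t1|t1] := leP (normc t) 1.
  have := mxnorm1D (t *: y - z) ((A' - A) *m y); rewrite -fwd.
  have := mxnorm1D (t *: y) (- z); rewrite mxnorm1N mxnorm1Z.
  have := mxnorm1M (A' - A) y.
  have : normc t * mxnorm1 y <= mxnorm1 y by rewrite ler_piMl.
  clear -x0 y0 z0 w0 e1 e2; lra.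
have : mxnorm1 x <= normc t * mxnorm1 x by rewrite ler_peMl// ltW.
rewrite -mxnorm1Z bwd.
have := mxnorm1D (y + w) ((t%:M - A) *m (B - A) *m w).
have := mxnorm1D y w.
have := mxnorm1M ((t%:M - A) *m (B - A)) w.
have := mxnorm1M (t%:M - A) (B - A); rewrite mxnorm1_trB => h1 h2.
have : mxnorm1 ((t%:M - A) *m (B - A)) * mxnorm1 w <=
   mxnorm1 A * mxnorm1 (B - A) * mxnorm1 w by rewrite ler_wpM2r.
clear -x0 y0 z0 w0 e1 e2 h1 h2; lra.
Qed.

End MatrixNorm.

(** * Cocycles with approximate periods *)

Section Gordon.
Variable R : realType.
Local Notation C := R[i].
Variable P : int -> 'M[C]_2.

Fixpoint cocycle (n : int) (k : nat) : 'M[C]_2 :=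
  if k is k'.+1 then P (n + k'%:Z) *m cocycle n k' else 1%:M.

Lemma cocycleP (phi : int -> 'cV[C]_2) n k :
  (forall m, phi (m + 1) = P m *m phi m) ->
  phi (n + k%:Z) = cocycle n k *m phi n.
Proof.
move=> phiS; elim: k => [|k IHk] /=; first by rewrite addr0 mul1mx.
by rewrite -mulmxA -IHk -phiS -addrA -PoszD addn1.
Qed.

Lemma det_cocycle n k : (forall m, \det (P m) = -1) ->
  \det (cocycle n k) = (-1) ^+ k.
Proof.
move=> detP; elim: k => [|k IHk] /=; first by rewrite det1.
by rewrite det_mulmx detP IHk exprS.
Qed.

Variable K : R.
Hypothesis K1 : 1 <= K.
Hypothesis PK : forall n, mxnorm1 (P n) <= K.

(** The factor 2 is the norm of the empty product. *)
Lemma mxnorm1_cocycle n k : mxnorm1 (cocycle n k) <= 2 * K ^+ k.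
Proof.
elim: k => [|k IHk] /=.
  rewrite expr0 mulr1 /mxnorm1 !sum_ord2 !mxE /= ?mulr1n ?mulr0n.
  by rewrite expr1n expr0n /= !addr0 sqrtr0 sqrtr1; lra.
apply: le_trans (mxnorm1M _ _) _; rewrite exprS mulrCA.
by apply: ler_pM; rewrite ?mxnorm1_ge0.
Qed.

(** Telescoping: the products over two blocks differ by [k] terms, each with
    one factor replaced by a difference. *)
Lemma mxnorm1_cocycleB m n k eta :
  (forall i : nat, mxnorm1 (P (m + i%:Z) - P (n + i%:Z)) <= eta) ->
  mxnorm1 (cocycle m k - cocycle n k) <= 2 * k%:R * K ^+ k * eta.
Proof.
move=> Peta; have eta0 : 0 <= eta.
  by apply: le_trans (Peta 0); exact: mxnorm1_ge0.
have K0 : 0 <= K by apply: le_trans K1; exact: ler01.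
elim: k => [|k IHk] /=.
  by rewrite subrr mulr0 !mul0r /mxnorm1 !sum_ord2 !mxE normc0 !addr0.
set A := cocycle m k; set B := cocycle n k.
have -> : P (m + k%:Z) *m A - P (n + k%:Z) *m B =
    P (m + k%:Z) *m (A - B) + (P (m + k%:Z) - P (n + k%:Z)) *m B.
  by rewrite mulmxBr mulmxBl subrKA.
apply: le_trans (mxnorm1D _ _) _.
have h1 : mxnorm1 (P (m + k%:Z) *m (A - B)) <= K * (2 * k%:R * K ^+ k * eta).
  by apply: le_trans (mxnorm1M _ _) _; apply: ler_pM; rewrite ?mxnorm1_ge0.
have h2 : mxnorm1 ((P (m + k%:Z) - P (n + k%:Z)) *m B) <= eta * (2 * K ^+ k).
  apply: le_trans (mxnorm1M _ _) _; apply: ler_pM; rewrite ?mxnorm1_ge0//.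
  exact: mxnorm1_cocycle.
apply: le_trans (lerD h1 h2) _.
have -> : 2 * k.+1%:R * K ^+ k.+1 * eta =
   K * (2 * k%:R * K ^+ k * eta) + K * (eta * (2 * K ^+ k)).
  by rewrite -natr1 exprS; ring.
by rewrite lerD2l ler_peMl//; rewrite !mulr_ge0// exprn_ge0.
Qed.

(** In [three_block_bound] the error terms carry, up to constants, the factors
    [q K^q L / q!] and [q K^(2q) L / q!], which tend to 0; so the state at [n] is
    bounded by five times the states far away.  Evenness of [q] makes the
    determinant of the block equal to 1. *)
Lemma gordon (phi : int -> 'cV[C]_2) (L : R) :
  (forall n, \det (P n) = -1) ->
  (forall n, phi (n + 1) = P n *m phi n) ->
  (forall j, exists q, [/\ (j <= q)%N, ~~ odd q &
     forall n, mxnorm1 (P (n + q%:Z) - P n) <= L / q`!%:R]) ->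
  (forall e : R, 0 < e -> exists N : nat, forall n : int,
     (N <= `|n|)%N -> mxnorm1 (phi n) < e) ->
  forall n, phi n = 0.
Proof.
move=> detP phiS Pq phi0 n; apply: mxnorm1_eq0; apply/eqP.
rewrite eq_le mxnorm1_ge0 andbT; apply/ler_addgt0Pl => e e0; rewrite addr0.
have K0 : 0 < K by apply: lt_le_trans K1; exact: ltr01.
have [N phiN] := phi0 (e / 5) (divr_gt0 e0 (ltr0Sn _ _)).
have [j0 _ expj0] : \forall q \near \oo,
    4 * L * ((2 * K ^+ 2) ^+ q / q`!%:R) <= 1.
  have L0 : 0 < 4 * `|L| + 1 by have := normr_ge0 L; lra.
  have /cvgr0Pnorm_lt/(_ _ (divr_gt0 ltr01 L0)) :=
    @cvg_exp_coeff R (2 * K ^+ 2).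
  apply: filterS => q; rewrite ltr_pdivlMr// => /ltW ltq.
  have := ler_norm (L * exp_coeff (2 * K ^+ 2) q).
  rewrite normrM -[_ ^+ q / _]/(exp_coeff (2 * K ^+ 2) q).
  have := normr_ge0 (exp_coeff (2 * K ^+ 2) q).
  clear -ltq; lra.
have [q [jq qev Pqn]] := Pq (maxn j0 (N + `|n|)).
have big m : (q <= `|m - n|)%N -> mxnorm1 (phi m) < e / 5.
  by move=> qm; apply: phiN; lia.
have hx : phi n = cocycle (n - q%:Z) q *m phi (n - q%:Z).
  by rewrite -cocycleP// subrK.
have dA : \det (cocycle n q) = 1.
  by rewrite det_cocycle// -signr_odd (negbTE qev) expr0.
have := three_block_bound dA hx (cocycleP n q phiS)
  (cocycleP (n + q%:Z) q phiS).
have y1 := big (n + q%:Z) ltac:(lia).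
have z1 := big (n + q%:Z + q%:Z) ltac:(lia).
have w1 := big (n - q%:Z) ltac:(lia).
set eta := L / q`!%:R in Pqn.
have eta0 : 0 <= eta by apply: le_trans (Pqn 0); exact: mxnorm1_ge0.
(* Here [q <= 2 ^ q] brings the bound to the form of a coefficient of the
   exponential series. *)
have E1 : 4 * q%:R * K ^+ q * K ^+ q * eta <= 1.
  apply: le_trans (expj0 q _); last by rewrite /=; lia.
  rewrite exprMn -exprM mulnC exprM expr2.
  have -> : 4 * L * (2 ^+ q * (K ^+ q * K ^+ q) / q`!%:R) =
     4 * 2 ^+ q * K ^+ q * K ^+ q * eta by rewrite /eta; ring.
  apply: ler_wpM2r => //.
  do 2!(apply: ler_wpM2r; first by rewrite exprn_ge0// ltW).
  apply: ler_wpM2l => //.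
  by rewrite -natrX ler_nat ltnW// ltn_expl.
have dA' : mxnorm1 (cocycle (n + q%:Z) q - cocycle n q) <=
    2 * q%:R * K ^+ q * eta.
  by apply: mxnorm1_cocycleB => i; rewrite addrAC.
have dB : mxnorm1 (cocycle (n - q%:Z) q - cocycle n q) <=
    2 * q%:R * K ^+ q * eta.
  apply: mxnorm1_cocycleB => i; rewrite -opprB mxnorm1N.
  by rewrite (_ : n + i%:Z = n - q%:Z + i%:Z + q%:Z) // addrAC subrK.
clearbody eta; have nA := mxnorm1_cocycle n q.
have Kq1 : 1 <= K ^+ q by exact: exprn_ege1.
have qK0 : 0 <= 2 * q%:R * K ^+ q * eta.
  by rewrite !mulr_ge0 ?exprn_ge0 ?(ltW K0).
have f1 : mxnorm1 (cocycle (n + q%:Z) q - cocycle n q) <= 1.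
  apply: le_trans dA' _; apply: le_trans E1; nra.
have f2 : mxnorm1 (cocycle n q) *
    mxnorm1 (cocycle (n - q%:Z) q - cocycle n q) <= 1.
  apply: le_trans E1.
  apply: (@le_trans _ _ ((2 * K ^+ q) * (2 * q%:R * K ^+ q * eta))).
    by apply: ler_pM; rewrite ?mxnorm1_ge0.
  nra.
have g1 := ler_pM (mxnorm1_ge0 _) (mxnorm1_ge0 _) f1 (ltW y1).
have g2 := ler_pM (mulr_ge0 (mxnorm1_ge0 _) (mxnorm1_ge0 _)) (mxnorm1_ge0 _)
  f2 (ltW w1).
clear -g1 g2 y1 z1 w1; lra.
Qed.

End Gordon.

(** * Bounds for the one-step matrices *)

Section SzegoMatrices.
Variable R : realType.
Local Notation C := R[i].

Definition mx22 (a b c d : C) : 'M[C]_2 :=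
  \matrix_(i, j) (if i == 0 then if j == 0 then a else b
                  else if j == 0 then c else d).

Lemma mxnorm1_mx22 a b c d :
  mxnorm1 (mx22 a b c d) = normc a + normc b + (normc c + normc d).
Proof. by rewrite /mxnorm1 !sum_ord2 !mxE. Qed.

Lemma mx22B a b c d a' b' c' d' :
  mx22 a b c d - mx22 a' b' c' d' = mx22 (a - a') (b - b') (c - c') (d - d').
Proof. by apply/matrixP => i j; rewrite !mxE; do !case: ifP. Qed.

(** One step of the recursion is [szego z alpha] at an even site and [szego 1] of
    the conjugate of [alpha] at an odd site, so that both can be estimated
    together. *)
Definition szego (c x : C) : 'M[C]_2 :=
  ((Num.sqrt (1 - normc x ^+ 2))^-1)%:C%C *: mx22 (- x) c^-1 c (- x^*%C).

Lemma normc_conj (x : C) : normc x^*%C = normc x.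
Proof. by case: x => a b /=; rewrite sqrrN. Qed.

Lemma normc_real (s : R) : 0 <= s -> normc s%:C%C = s.
Proof. by move=> s0 /=; rewrite expr0n addr0 sqrtr_sqr ger0_norm. Qed.

Lemma mul_conjc (x : C) : x * x^*%C = ((normc x) ^+ 2)%:C%C.
Proof. by rewrite -sqr_normc rmorphXn. Qed.

Lemma sqrt_gt0_disk (x : C) : normc x < 1 -> 0 < Num.sqrt (1 - normc x ^+ 2).
Proof.
by move=> x1; rewrite sqrtr_gt0 subr_gt0 expr_lt1// normc_ge0.
Qed.

Lemma det_szego (c x : C) : c != 0 -> normc x < 1 -> \det (szego c x) = -1.
Proof.
move=> c0 x1; rewrite detZ det_mx22 !mxE /= mulrNN mul_conjc mulVf//.
have s0 := sqrt_gt0_disk x1; rewrite -rmorphXn /= exprVn sqr_sqrtr; last first.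
  by move: s0; rewrite sqrtr_gt0 => /ltW.
have : 1 - normc x ^+ 2 != 0 by move: s0; rewrite sqrtr_gt0 => /gt_eqF ->.
set w := normc x ^+ 2 => w0.
have -> : w%:C%C - 1 = (w - 1)%:C%C by rewrite rmorphB.
rewrite -rmorphM -[w - 1]opprB mulrN mulVf// rmorphN //.
Qed.

Variable r : R.
Hypothesis r0 : 0 <= r.
Hypothesis r1 : r < 1.
Let m := Num.sqrt (1 - r ^+ 2).

Let m_gt0 : 0 < m. Proof. by rewrite sqrtr_gt0 subr_gt0 expr_lt1. Qed.

Lemma sqrt_ge_disk (x : C) : normc x <= r -> m <= Num.sqrt (1 - normc x ^+ 2).
Proof.
move=> xr; rewrite ler_wsqrtr// lerD2l lerN2.
by rewrite lerXn2r ?nnegrE ?normc_ge0.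
Qed.

Lemma inv_sqrt_le (x : C) : normc x <= r ->
  (Num.sqrt (1 - normc x ^+ 2))^-1 <= m^-1.
Proof.
move=> /sqrt_ge_disk mx; rewrite lef_pV2 ?posrE//.
exact: lt_le_trans mx.
Qed.

(** Rationalizing, [1/s - 1/t = (t^2 - s^2) / (s t (s + t))], where
    [t^2 - s^2] is the difference of the squared moduli of [x] and [y]. *)
Lemma inv_sqrt_lip (x y : C) : normc x <= r -> normc y <= r ->
  `|(Num.sqrt (1 - normc x ^+ 2))^-1 - (Num.sqrt (1 - normc y ^+ 2))^-1| <=
  m^-1 ^+ 3 * normc (x - y).
Proof.
move=> xr yr; have mx := sqrt_ge_disk xr; have my := sqrt_ge_disk yr.
have x0 := normc_ge0 x; have y0 := normc_ge0 y.
set s := Num.sqrt _ in mx *; set t := Num.sqrt _ in my *.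
have s0 : 0 < s by exact: lt_le_trans mx.
have t0 : 0 < t by exact: lt_le_trans my.
have s2 : s ^+ 2 = 1 - normc x ^+ 2.
  by move: s0; rewrite sqrtr_gt0 => /ltW /sqr_sqrtr.
have t2 : t ^+ 2 = 1 - normc y ^+ 2.
  by move: t0; rewrite sqrtr_gt0 => /ltW /sqr_sqrtr.
clearbody s t.
have -> : s^-1 - t^-1 =
    (normc x - normc y) * (normc x + normc y) / (s * t * (s + t)).
  have -> : (normc x - normc y) * (normc x + normc y) = (t - s) * (s + t).
    by rewrite -subr_sqr [s + t]addrC -subr_sqr s2 t2; ring.
  by field; rewrite !gt_eqF// addr_gt0.
rewrite normrM normrM normfV.
have xy : `|normc x - normc y| <= normc (x - y).
  have := le_normcD (x - y) y; have := le_normcD (y - x) x.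
  rewrite !subrK normcB => h1 h2; rewrite ler_norml; apply/andP; split; lra.
have -> : `|normc x + normc y| = normc x + normc y.
  by rewrite ger0_norm// addr_ge0.
have -> : `|s * t * (s + t)| = s * t * (s + t).
  by rewrite ger0_norm// !mulr_ge0 ?addr_ge0 ?ltW.
rewrite -mulrA [leRHS]mulrC; apply: ler_pM => //.
  by rewrite divr_ge0 ?mulr_ge0 ?addr_ge0 ?(ltW s0) ?(ltW t0).
rewrite exprVn ler_pdivrMr ?mulr_gt0 ?addr_gt0// mulrC ler_pdivlMr ?exprn_gt0//.
have xy2 : normc x + normc y <= 2.
  by apply: le_trans (lerD xr yr) _; rewrite [2]mulr2n lerD ?ltW.
have m0 := ltW m_gt0.
have h : m * m * (m + m) <= s * t * (s + t).
  have mm : m * m <= s * t by exact: ler_pM.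
  by apply: ler_pM; [exact: mulr_ge0|exact: addr_ge0|exact: mm|exact: lerD].
have m3 : 0 <= m ^+ 3 by rewrite exprn_ge0// ltW.
rewrite (_ : m * m * (m + m) = 2 * m ^+ 3) in h; last by ring.
by apply: le_trans h; rewrite ler_wpM2r.
Qed.

Let M (c : C) := 2 + normc c + normc c^-1.

Let mxnorm1_szego c x : normc x <= r -> mxnorm1 (szego c x) <= m^-1 * M c.
Proof.
move=> xr; rewrite mxnorm1Z normc_real ?invr_ge0 ?sqrtr_ge0//.
apply: ler_pM; rewrite ?invr_ge0 ?sqrtr_ge0 ?mxnorm1_ge0 ?inv_sqrt_le//.
rewrite mxnorm1_mx22 !normcN normc_conj /M.
by have x1 := le_trans xr (ltW r1); lra.
Qed.

Let mxnorm1_szegoB c x y : normc x <= r -> normc y <= r ->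
  mxnorm1 (szego c x - szego c y) <=
  (m^-1 ^+ 3 * M c + 2 * m^-1) * normc (x - y).
Proof.
move=> xr yr; rewrite /szego.
set s := (Num.sqrt (1 - normc x ^+ 2))^-1.
set t := (Num.sqrt (1 - normc y ^+ 2))^-1.
set A := mx22 _ _ _ _; set B := mx22 _ _ _ _.
have -> : s%:C%C *: A - t%:C%C *: B = (s - t)%:C%C *: A + t%:C%C *: (A - B).
  by rewrite rmorphB /= scalerBl scalerBr subrKA.
apply: le_trans (mxnorm1D _ _) _; rewrite !mxnorm1Z.
have -> : normc (s - t)%:C%C = `|s - t|.
  by rewrite /= expr0n addr0 sqrtr_sqr.
rewrite [normc t%:C%C]normc_real; last by rewrite invr_ge0 sqrtr_ge0.
rewrite mulrDl; apply: lerD.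
  rewrite mulrAC; apply: ler_pM; rewrite ?mxnorm1_ge0// ?inv_sqrt_lip//.
  rewrite mxnorm1_mx22 !normcN normc_conj /M.
  by have x1 := le_trans xr (ltW r1); lra.
rewrite [2 * _]mulrC -mulrA; apply: ler_pM;
  rewrite ?mxnorm1_ge0 ?invr_ge0 ?sqrtr_ge0 ?inv_sqrt_le//.
rewrite mx22B mxnorm1_mx22 !subrr normc0 -!opprD !normcN -rmorphB normc_conj.
by lra.
Qed.

Lemma szego_lipschitz c : exists K : R, [/\ 0 <= K,
  forall x, normc x <= r -> mxnorm1 (szego c x) <= K &
  forall x y, normc x <= r -> normc y <= r ->
    mxnorm1 (szego c x - szego c y) <= K * normc (x - y)].
Proof.
set K1 := m^-1 * M c; set K2 := m^-1 ^+ 3 * M c + 2 * m^-1.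
have mV0 : 0 <= m^-1 by rewrite invr_ge0 ltW.
have M0 : 0 <= M c by rewrite /M !addr_ge0 ?normc_ge0.
have K10 : 0 <= K1 by exact: mulr_ge0.
have K20 : 0 <= K2 by rewrite addr_ge0 ?mulr_ge0 ?exprn_ge0.
exists (K1 + K2); split=> [|x xr|x y xr yr]; first exact: addr_ge0.
  by apply: le_trans (mxnorm1_szego c xr) _; rewrite lerDl.
apply: le_trans (mxnorm1_szegoB c xr yr) _.
by apply: ler_wpM2r; [exact: normc_ge0|rewrite lerDr].
Qed.

End SzegoMatrices.

(** * The eigenvalue equation as a cocycle *)

Section CMVTransfer.
Variable R : realType.
Local Notation C := R[i].
Variables (a : int -> C) (u : int -> C) (z : C).
Hypothesis a1 : forall n, normc (a n) < 1.
Hypothesis Eu : extCMV a u = (fun n => z * u n).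

(** The sequence [v = M u] of the factorization [E = L M], where [M] acts by the
    blocks of rows [(conj a_n, rho_n)] and [(rho_n, - a_n)] on the sites [n] and
    [n + 1] for odd [n], and [L] does so for even [n]. *)
Definition half_step (n : int) : C :=
  if (2 %| n)%Z then rho a (n - 1) * u (n - 1) - a (n - 1) * u n
  else (a n)^*%C * u n + rho a n * u (n + 1).

Definition transfer (n : int) : 'M[C]_2 :=
  if (2 %| n)%Z then szego z (a n) else szego 1 (a n)^*%C.

Definition cmv_state (n : int) : 'cV[C]_2 :=
  \col_i (if i == 0 then u n else half_step n).

Lemma rho_neq0 n : rho a n != 0.
Proof.
by rewrite /rho fmorph_eq0 gt_eqF// sqrt_gt0_disk.
Qed.

Lemma rho_sqr n : rho a n ^+ 2 = 1 - a n * (a n)^*%C.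
Proof.
rewrite mul_conjc -rmorphXn /= sqr_sqrtr ?rmorphB//.
by have := sqrt_gt0_disk (a1 n); rewrite sqrtr_gt0 => /ltW.
Qed.

Lemma dvdz2S n : (2 %| n + 1)%Z = ~~ (2 %| n)%Z.
Proof. by rewrite !dvdzE /=; lia. Qed.

(** The equation [L v = z u]. *)
Lemma half_step_even n : (2 %| n)%Z ->
  (a n)^*%C * half_step n + rho a n * half_step (n + 1) = z * u n /\
  rho a n * half_step n - a n * half_step (n + 1) = z * u (n + 1).
Proof.
move=> n2; have m2 : ~~ (2 %| n - 1)%Z by rewrite -dvdz2S subrK.
have [] := extCMV_odd a u m2.
rewrite Eu /half_step n2 dvdz2S n2 /= subrK.
have -> : n - 1 + 2 = n + 1 by lia.
have -> : n - 1 + 3 = n + 1 + 1 by lia.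
by move=> -> ->; split; ring.
Qed.

(** The equation [v = M u]. *)
Lemma half_step_odd n : ~~ (2 %| n)%Z ->
  half_step n = (a n)^*%C * u n + rho a n * u (n + 1) /\
  half_step (n + 1) = rho a n * u n - a n * u (n + 1).
Proof. by move=> n2; rewrite /half_step dvdz2S (negbTE n2) /= addrK. Qed.

(** A block of [L] or [M] maps the pair [(x0, x1)] to [(w0, w1)]; since its
    off-diagonal entry is invertible, the quantities at the right site can be
    expressed by those at the left site. *)
Lemma theta_solve (b d w0 w1 x0 x1 : C) : d != 0 -> d ^+ 2 = 1 - b * b^*%C ->
  w0 = b^*%C * x0 + d * x1 -> w1 = d * x0 - b * x1 ->
  x1 = d^-1 * (w0 - b^*%C * x0) /\ w1 = d^-1 * (x0 - b * w0).
Proof.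
move=> d0 d2 -> ->; split; first by field.
rewrite -[X in _ = _ * (X - _)]mul1r.
rewrite (_ : 1 = d ^+ 2 + b * b^*%C); last by rewrite d2 subrK.
by field.
Qed.

Lemma mulmx_mx22 (b c d e x y : C) :
  mx22 b c d e *m (\col_i (if i == 0 then x else y)) =
  \col_i (if i == 0 then b * x + c * y else d * x + e * y) :> 'cV_2.
Proof. by apply: mx22P => j; rewrite !mxE sum_ord2 !mxE. Qed.

Lemma cmv_stateS n : z != 0 -> cmv_state (n + 1) = transfer n *m cmv_state n.
Proof.
move=> z0; rewrite /transfer /cmv_state; case: ifPn => n2; rewrite /szego.
  have [e1 e2] := half_step_even n2.
  have [f1 f2] := theta_solve (rho_neq0 n) (rho_sqr n) (esym e1) (esym e2).
  rewrite -scalemxAl mulmx_mx22; apply: mx22P => j; rewrite !mxE /=.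
    apply: (mulfI z0); rewrite f2 /rho fmorphV /=.
    by field; rewrite z0 rho_neq0.
  by rewrite f1 /rho fmorphV; ring.
have [e1 e2] := half_step_odd n2.
have [f1 f2] := theta_solve (rho_neq0 n) (rho_sqr n) e1 e2.
rewrite -scalemxAl mulmx_mx22 normc_conj conjcK.
apply: mx22P => j; rewrite !mxE /= fmorphV ?invr1.
  by rewrite f1 /rho; ring.
by rewrite f2 /rho; ring.
Qed.

Lemma det_transfer n : z != 0 -> \det (transfer n) = -1.
Proof.
move=> z0; rewrite /transfer; case: ifP => _.
  exact: det_szego.
by apply: det_szego; [exact: oner_neq0|rewrite normc_conj].
Qed.

(** The blocks of [L] and [M] are invertible. *)
Lemma extCMV_inj : z = 0 -> u = (fun=> 0).
Proof.
move=> z0.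
have inj (b d x0 x1 : C) : d ^+ 2 = 1 - b * b^*%C ->
    b^*%C * x0 + d * x1 = 0 -> d * x0 - b * x1 = 0 -> x0 = 0 /\ x1 = 0.
  move=> d2 e1 e2; split.
    have -> : x0 = b * (b^*%C * x0 + d * x1) + d * (d * x0 - b * x1) +
      (1 - b * b^*%C - d ^+ 2) * x0 by ring.
    by rewrite e1 e2 d2 subrr; ring.
  have -> : x1 = d * (b^*%C * x0 + d * x1) - b^*%C * (d * x0 - b * x1) +
    (1 - b * b^*%C - d ^+ 2) * x1 by ring.
  by rewrite e1 e2 d2 subrr; ring.
have v0 n : half_step n = 0.
  have [n2|n2] := boolP (2 %| n)%Z.
    have [] := half_step_even n2; rewrite z0 !mul0r => e1 e2.
    by case: (inj _ _ _ _ (rho_sqr n) e1 e2).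
  have n2' : (2 %| n - 1)%Z by rewrite -[n](subrK 1) dvdz2S negbK in n2.
  have [] := half_step_even n2'; rewrite z0 !mul0r subrK => e1 e2.
  by case: (inj _ _ _ _ (rho_sqr (n - 1)) e1 e2).
apply/funext => n; have [n2|n2] := boolP (2 %| n)%Z.
  have n2' : ~~ (2 %| n - 1)%Z by rewrite -dvdz2S subrK.
  have [] := half_step_odd n2'; rewrite !v0 subrK => e1 e2.
  by case: (inj _ _ _ _ (rho_sqr (n - 1)) (esym e1) (esym e2)).
have [] := half_step_odd n2; rewrite !v0 => e1 e2.
by case: (inj _ _ _ _ (rho_sqr n) (esym e1) (esym e2)).
Qed.

Lemma normc_rho_le1 n : normc (rho a n) <= 1.
Proof.
rewrite normc_real ?sqrtr_ge0// -[leRHS]sqrtr1 ler_wsqrtr//.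
by rewrite lerBlDr lerDl exprn_ge0// normc_ge0.
Qed.

Lemma mxnorm1_cmv_state n :
  mxnorm1 (cmv_state n) <=
  normc (u (n - 1)) + 2 * normc (u n) + normc (u (n + 1)).
Proof.
rewrite /mxnorm1 sum_ord2 !big_ord1 !mxE /= /half_step.
have p1 := normc_ge0 (u (n - 1)); have p2 := normc_ge0 (u (n + 1)).
have mul1 (b x : C) : normc b <= 1 -> normc (b * x) <= normc x.
  by move=> b1; rewrite normcM ler_piMl ?normc_ge0.
case: ifP => _.
  have := le_normcD (rho a (n - 1) * u (n - 1)) (- (a (n - 1) * u n)).
  rewrite normcN; have := mul1 _ (u (n - 1)) (normc_rho_le1 (n - 1)).
  have := mul1 _ (u n) (ltW (a1 (n - 1))).
  clear -p1 p2; lra.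
have := le_normcD ((a n)^*%C * u n) (rho a n * u (n + 1)).
have := mul1 _ (u (n + 1)) (normc_rho_le1 n).
have : normc ((a n)^*%C * u n) <= normc (u n).
  by apply: mul1; rewrite normc_conj ltW.
clear -p1 p2; lra.
Qed.

End CMVTransfer.

(** Infinitely many terms of size at least [e] would make the sum of squares
    exceed any bound. *)
Lemma l2_decay (R : realType) (u : int -> R[i]) (e : R) : l2 u -> 0 < e ->
  exists N : nat, forall n : int, (N <= `|n|)%N -> normc (u n) < e.
Proof.
move=> u2 e0; pose A := [set n : int | e <= normc (u n)].
have finA : finite_set A.
  apply: contrapT.
  set S := \esum_(n in [set: int]) `|(normc (u n) ^+ 2)%:E|%E.
  have Sfin : (S < +oo)%E by exact: u2.
  have S0 : (0 <= S)%E by apply: esum_ge0.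
  have SE : S = (fine S)%:E by rewrite fineK// ge0_fin_numE.
  pose M := (Num.truncn (fine S / e ^+ 2)).+1.
  move/(infinite_set_fset M) => [B BA MB].
  have : ((M%:R * e ^+ 2)%:E <= S)%E.
    apply: esum_ge; exists [set` B]; first by split=> //; exact: finite_fset.
    rewrite fsbig_finite//= set_fsetK.
    apply: (@le_trans _ _ (\sum_(i <- B) (e ^+ 2)%:E)%E).
      rewrite sumEFin lee_fin big_const_seq count_predT iter_addr_0.
      rewrite -[leRHS]mulr_natl.
      by rewrite ler_wpM2r ?ler_nat ?exprn_ge0 ?ltW.
    rewrite !big_seq; apply: lee_sum => n /BA /= en.
    rewrite lee_fin ger0_norm ?exprn_ge0 ?normc_ge0//.
    by rewrite lerXn2r ?nnegrE ?normc_ge0// ltW.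
  rewrite SE lee_fin leNgt => /negP; apply.
  by rewrite -ltr_pdivrMr ?exprn_gt0// truncnS_gt.
have [B AB] : exists B : {fset int}, A = [set` B] by exact/finite_fsetP.
exists (\sum_(n <- B) `|n|).+1%N => n Nn; rewrite ltNge; apply/negP => en.
have nB : n \in B by have : A n by []; rewrite AB.
move: Nn; rewrite ltnNge => /negP; apply.
by rewrite (big_fsetD1 n nB)/= leq_addr.
Qed.

(** * Generic sampling functions *)

(** The bound [r] keeps the coefficients away from the unit circle, where the
    transfer matrices blow up.  The approximate period is even because the two
    kinds of transfer matrices alternate. *)
Lemma cmv_gordon (R : realType) (al : int -> R[i]) (r : R) :
  r < 1 -> (forall n, normc (al n) <= r) ->
  (forall j, exists q, [/\ (j <= q)%N, ~~ odd q &
     forall n, normc (al (n + q%:Z) - al n) <= (q`!%:R)^-1]) ->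
  point_spectrum (extCMV al) = set0.
Proof.
move=> r1 alr alq; apply/seteqP; split=> // z [u [u2 u0 Eu]].
have r0 : 0 <= r by apply: le_trans (alr 0); exact: normc_ge0.
have al1 n : normc (al n) < 1 by apply: le_lt_trans r1.
have [z0|z0] := eqVneq z 0; first by apply/u0/(extCMV_inj al1 Eu).
have [Kz [Kz0 szK szL]] := szego_lipschitz r0 r1 z.
have [Ko [Ko0 soK soL]] := szego_lipschitz r0 r1 1.
have conjr n : normc (al n)^*%C <= r by rewrite normc_conj.
pose K := 1 + Kz + Ko.
have [K1 KzK KoK] : [/\ 1 <= K, Kz <= K & Ko <= K] by rewrite /K; split; lra.
pose P := transfer al z.
have PK n : mxnorm1 (P n) <= K.
  by rewrite /P /transfer; case: ifP => _; [apply: le_trans KzK; exact: szK|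
    apply: le_trans KoK; exact: soK].
have PL j : exists q, [/\ (j <= q)%N, ~~ odd q &
    forall n, mxnorm1 (P (n + q%:Z) - P n) <= K / q`!%:R].
  have [q [jq qev alqn]] := alq j; exists q; split=> // n.
  have par : (2 %| n + q%:Z)%Z = (2 %| n)%Z by rewrite !dvdzE /=; lia.
  apply: le_trans (ler_wpM2l (le_trans ler01 K1) (alqn n)).
  rewrite /P /transfer par; case: ifP => _.
    apply: le_trans (szL _ _ (alr _) (alr _)) _.
    by apply: ler_wpM2r KzK; exact: normc_ge0.
  apply: le_trans (soL _ _ (conjr _) (conjr _)) _.
  by rewrite -rmorphB normc_conj; apply: ler_wpM2r KoK; exact: normc_ge0.
apply: u0; apply/funext => n.
suff : cmv_state al u n = 0.
  by move=> /matrixP/(_ 0 0); rewrite !mxE.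
apply: (@gordon _ P K K1 PK (cmv_state al u) K _ _ PL).
- by move=> k; exact: det_transfer.
- by move=> k; exact: cmv_stateS.
move=> e e0; have [N uN] := l2_decay u2 (divr_gt0 e0 (ltr0Sn _ 3)).
exists N.+1 => k Nk.
apply: le_lt_trans (mxnorm1_cmv_state u al1 k) _.
have := uN (k - 1) ltac:(lia); have := uN k ltac:(lia).
have := uN (k + 1) ltac:(lia); lra.
Qed.

Lemma compact_disk_bound (R : realType) (X : topologicalType)
    (f : X -> R[i]^o) :
  compact [set: X] -> continuous f -> (forall x, normc (f x) < 1) ->
  exists2 r : R, r < 1 & forall x, normc (f x) <= r.
Proof.
move=> /compact_near_coveringP cX cf f1.
have : \forall e \near (0 : R)^'+,
    [set: X] `<=` (fun x => normc (f x) <= 1 - e).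
  apply: (cX R _ (fun e x => normc (f x) <= 1 - e)) => x _.
  set d := (1 - normc (f x)) / 2.
  have d0 : 0 < d by have := f1 x; rewrite /d; lra.
  exists ([set x' | normc ((f x : R[i]) - f x') < d], [set e | e <= d]).
    split=> /=; first by apply: (@near_normc _ _ f _ d _ d0); exact: cf.
    exact: nbhs_right_le.
  move=> [x' e] /= [hx ed].
  have := le_normcD ((f x' : R[i]) - f x) (f x).
  by rewrite subrK normcB; rewrite /d in hx ed; lra.
move=> fe; have [e [e0 {}fe]] : exists e : R, 0 < e /\
    [set: X] `<=` (fun x => normc (f x) <= 1 - e).
  apply: (@filter_ex _ (0 : R)^'+).
  by apply: filterI fe; exact: nbhs_right_gt.
by exists (1 - e) => [|x]; [lra|exact: fe].
Qed.

Section GordonFunctions.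
Variables (R : realType) (Omega : topologicalZmodType) (a : Omega).
Local Notation SF := (sampling_functions R Omega).

(** The existential bound [e] is the formulation, free of suprema, of a sup norm
    strictly less than [1 / q!]. *)
Definition gordon_fun (j : nat) : set SF :=
  [set f | exists q, [/\ (j <= q)%N, ~~ odd q & exists2 e : R, e < (q`!%:R)^-1 &
     forall w, normc (set_val f (w + a *+ q) - set_val f w) <= e]].

Lemma open_gordon_fun j : open (gordon_fun j).
Proof.
rewrite openE => f [q [jq qev [e eq fe]]]; apply/nbhs_sampling_functions.
set d := ((q`!%:R)^-1 - e) / 4.
have d0 : 0 < d by rewrite /d; lra.
exists d => // g fg; exists q; split=> //.
exists (e + 2 * d); first by rewrite /d; lra.
move=> w; have h1 := fg w; have h2 := fg (w + a *+ q); have h3 := fe w.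
have := le_normcB (set_val f (w + a *+ q)) (set_val g (w + a *+ q))
  (set_val g w).
have := le_normcB (set_val f w) (set_val f (w + a *+ q)) (set_val g w).
rewrite normcB in h2.
by lra.
Qed.

Lemma periodic_gordon_fun (f : SF) m : (0 < m)%N ->
  (forall w, set_val f (w + a *+ m) = set_val f w) ->
  forall j, gordon_fun j f.
Proof.
move=> m0 fm j; have fk k w : set_val f (w + a *+ m *+ k) = set_val f w.
  elim: k w => [|k IHk] w; first by rewrite mulr0n addr0.
  by rewrite mulrSr addrA fm IHk.
exists (m * (2 * j))%N; split.
- by rewrite mulnCA mulnA leq_pmull// muln_gt0.
- by rewrite !oddM /= andbF.
- exists 0; first by rewrite invr_gt0 ltr0n fact_gt0.
  by move=> w; rewrite mulrnA fk subrr normc0.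
Qed.

Lemma dense_gordon_fun : cantor_group Omega -> minimal (fun w => w + a) ->
  dense (\bigcap_j gordon_fun j).
Proof.
move=> [cO hO tO iO] mina O [f Of] oO.
have /nbhs_sampling_functions[e e0 eO] : nbhs f O by exact: open_nbhs_nbhs.
have [cf f1] := set_valP f.
have [S [r [oS S0 SB rS [cfr fr]]]] :=
  @subgroup_periodic_approx R Omega (set_val f) e cO hO tO cf e0.
have [m m0 Sm] := translation_returns hO iO mina oS S0 SB.
have gP : SF (set_val f \o r) by split=> // w; exact: f1.
pose g : SF :=
  exist _ (set_val f \o r : {uniform Omega -> R[i]^o}) (mem_set gP).
exists g; split; first by apply: eO => w; exact: fr.
move=> j _; apply: (@periodic_gordon_fun g m m0) => w.
by rewrite -[LHS]/(set_val f (r (w + a *+ m))) rS.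
Qed.

End GordonFunctions.

Theorem theorem1 (R : realType) (Omega : topologicalZmodType)
  (T : Omega -> Omega) (hOmega : cantor_group Omega)
  (hT : is_translation T) (hmin : minimal T) :
  exists G : set (sampling_functions R Omega),
    [/\ dense G, Gdelta G &
      forall f : sampling_functions R Omega, G f ->
      forall w : Omega,
        point_spectrum (extCMV (fun n : int => set_val f (iterz T n w))) = set0].
Proof.
have [a Ta] := hT; have {Ta hT}TE : T = (fun w => w + a) by exact/funext.
subst T; exists (\bigcap_j @gordon_fun R Omega a j); split.
- exact: dense_gordon_fun.
- by exists (@gordon_fun R Omega a) => // j; exact: open_gordon_fun.
move=> f Gf w; have [cf f1] := set_valP f; have [cO _ _ _] := hOmega.
have [r r1 fr] := compact_disk_bound cO cf f1.
apply: (@cmv_gordon _ _ r r1) => [n|j]; first exact: fr.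
have [q [jq qev [e eq fe]]] := Gf j I.
exists q; split=> // n; apply: le_trans (ltW eq).
by rewrite !iterz_translation mulrzDr addrA; exact: fe.
Qed.
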